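(* Let $\mathbb{K}$ be an algebraically closed field, let $F=\{f_1,\dots,f_s\}\subset \mathbb{K}[x_1,\dots,x_n]$ be a polynomial system, let $G\subset S_n$ be a finite group of permutations, and let $d$ be a fixed positive integer. Suppose that $F$ is closed under the action of $G$ permuting the indices of the variables $x_1,\dots,x_n$ (that is, $g(f_i)\in F$ for all $g\in G$ and $f_i\in F$), and that the order $|G|$ and the characteristic of $\mathbb{K}$ are relatively prime (that is, $|G|$ is invertible in $\mathbb{K}$). Then the degree $d$ Nullstellensatz linear system of equations $M_{F,d}\,y=b_{F,d}$ has a solution over $\mathbb{K}$ if and only if the system of linear equations $\bar{M}_{F,d,G}\,\bar{y}=\bar{b}_{F,d,G}$ has a solution over $\mathbb{K}$.
   Context: Notation: $q$ is the maximum degree of the polynomials in $F$. For $\delta=(\delta_1,\dots,\delta_n)$ a tuple of nonnegative integers, $x^\delta=x_1^{\delta_1}\cdots x_n^{\delta_n}$ is a monomial of degree $\delta_1+\dots+\delta_n$. The linear system $M_{F,d}\,y=b_{F,d}$: the matrix $M_{F,d}$ has one row per monomial $x^\alpha$ in the $n$ variables of degree at most $q+d$, and one column per polynomial of the form $x^\delta f_i$, where $x^\delta$ is a monomial of degree at most $d$ and $f_i\in F$. Its entry $M_{x^\alpha,x^\delta f_i}$ is the coefficient of the monomial $x^\alpha$ in the polynomial $x^\delta f_i$. The unknown vector $y$ has one entry $y_{x^\delta f_i}$ for each polynomial of the form $x^\delta f_i$, where $x^\delta$ is a monomial of degree at most $d$ and $f_i\in F$. The vector $b_{F,d}$ has one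 entry for each monomial $x^\alpha$ of degree at most $q+d$, with $(b_{F,d})_{x^\alpha}=0$ if $\alpha\neq 0$ and $(b_{F,d})_{1}=1$. Group action: $G$ acts on $\mathbb{K}[x_1,\dots,x_n]$ by $\mathbb{K}$-algebra automorphisms permuting the variables, $g(x_i)=x_{g(i)}$. Hence $G$ acts on monomials of each given degree, and, when $F$ is closed under $G$, on the set of polynomials of the form $x^\delta f_i$ with $\deg x^\delta\le d$ and $f_i\in F$, via $g(x^\delta f_i)=g(x^\delta)\,g(f_i)$. Write $Orb(x^\alpha)$ and $Orb(x^\delta f_i)$ for the orbits under $G$. The linear system $\bar{M}_{F,d,G}\,\bar{y}=\bar{b}_{F,d,G}$: the rows of the orbit matrix $\bar{M}_{F,d,G}$ are indexed by the orbits $Orb(x^\alpha)$ of monomials $x^\alpha$ of degree at most $q+d$, and its columns are indexed by the orbits $Orb(x^\delta f_i)$, where $f_i\in F$ and $x^\delta$ has degree at most $d$. Its entries are $$\bar{M}_{Orb(x^\alpha),Orb(x^\delta f_i)}=\sum_{x^\gamma f_j\in Orb(x^\delta f_i)} M_{x^\alpha,x^\gamma f_j},$$ which is independent of the choice of the representative $x^\alpha$ of its orbit. The unknown vector $\bar{y}$ has one entry $\bar{y}_{Orb(x^\delta f_i)}$ for each such polynomial orbit. The vector $\bar{b}_{F,d,G}$ has one entry for each monomial orbit $Orb(x^\alpha)$, equal to $0$ if $\alpha\neq 0$ and equal to $1$ for $Orb(1)$. *)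

(* Defs.v *)
From HB Require Import structures.
From mathcomp Require Import all_boot all_order all_fingroup all_algebra.
From mathcomp Require Import finmap.
From mathcomp Require Export mpoly.

Set Implicit Arguments.
Unset Strict Implicit.
Unset Printing Implicit Defensive.

Import GRing.Theory.
Local Open Scope ring_scope.
Local Open Scope fset_scope.

Definition matrix_on (R : Type) (I J : finType) (E : I -> J -> R) :
    'M[R]_(#|I|, #|J|) :=
  \matrix_(i, j) E (enum_val i) (enum_val j).

Definition colvec_on (R : Type) (I : finType) (b : I -> R) : 'cV[R]_#|I| :=
  \col_i b (enum_val i).

Section Nullstellensatz.
Variables (K : fieldType) (n : nat).
Implicit Types (F : {fset {mpoly K[n]}}) (d : nat) (G : {group 'S_n}).
Implicit Types (m : 'X_{1..n}) (p : {mpoly K[n]}).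

(* [msize p] is the degree of [p] plus one (and 0 for [p = 0]). *)
Definition max_degree F : nat := (\max_(f <- F) (msize f).-1)%N.

(* A set of polynomials, not of pairs (delta, i): products x^delta f_i that
   coincide as polynomials give a single column. *)
Definition products F d : {fset {mpoly K[n]}} :=
  [fset 'X_[K, bmnm delta] * f | delta in [set: 'X_{1..n < d.+1}], f in F].

Definition nullM F d :
    'M[K]_(#|{: 'X_{1..n < (max_degree F + d).+1}}|, #|{: products F d}|) :=
  matrix_on (fun alpha (c : products F d) => (val c)@_(bmnm alpha)).

Definition nullb F d : 'cV[K]_#|{: 'X_{1..n < (max_degree F + d).+1}}| :=
  colvec_on (fun alpha => (bmnm alpha == 0%MM)%:R).

(* [msym g] is the algebra automorphism x_i |-> x_(g i); on exponents this
   makes the exponent of x_i in g(x^m) equal to m_(g^-1 i). *)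
Definition mact (g : 'S_n) m : 'X_{1..n} := [multinom m (g^-1%g i) | i < n].

Lemma msym_mact g m : msym g 'X_[K, m] = 'X_[K, mact g m].
Proof. exact: msymX. Qed.

Definition orb (T : choiceType) (act : 'S_n -> T -> T) G (x : T) : {fset T} :=
  [fset act g x | g in G].

Definition monomial_orbits F d G : {fset {fset 'X_{1..n}}} :=
  [fset orb mact G (bmnm alpha)
     | alpha in [set: 'X_{1..n < (max_degree F + d).+1}]].

Definition product_orbits F d G : {fset {fset {mpoly K[n]}}} :=
  [fset orb (@msym n K) G p | p in products F d].

(* Orbits are nonempty, so the default value 0 is never used. *)
Definition orb_repr (A : {fset 'X_{1..n}}) : 'X_{1..n} := head 0%MM (enum_fset A).

Definition orbitM F d G :
    'M[K]_(#|{: monomial_orbits F d G}|, #|{: product_orbits F d G}|) :=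
  matrix_on (fun (A : monomial_orbits F d G) (P : product_orbits F d G) =>
    \sum_(p <- val P) p@_(orb_repr (val A))).

Definition orbitb F d G : 'cV[K]_#|{: monomial_orbits F d G}| :=
  colvec_on (fun A : monomial_orbits F d G => (val A == orb mact G 0%MM)%:R).

Lemma mcoeff_msym g m p : (msym g p)@_(mact g m) = p@_m.
Proof.
by rewrite mcoeff_sym; congr (p@__); apply/mnmP=> i; rewrite !mnmE permK.
Qed.

Lemma orbP (T : choiceType) (act : 'S_n -> T -> T) G (x y : T) :
  reflect (exists2 g, g \in G & y = act g x) (y \in orb act G x).
Proof.
by apply: (iffP (imfsetP _ _ _ _)) => -[g Gg ->]; exists g.
Qed.

Lemma mact_orb_sum G m m' p : m' \in orb mact G m ->
  \sum_(h <- orb (@msym n K) G p) h@_m' = \sum_(h <- orb (@msym n K) G p) h@_m.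
Proof.
case/orbP=> g Gg ->.
have stab : [fset msym g h | h in orb (@msym n K) G p] = orb (@msym n K) G p.
  apply/fsetP => h; apply/imfsetP/orbP => /= [[h' /orbP[k Gk ->] ->]|[k Gk ->]].
    by exists (k * g)%g; rewrite ?groupM // msymMm.
  exists (msym (k * g^-1)%g p); last by rewrite -msymMm mulgKV.
  by apply/orbP; exists (k * g^-1)%g => //; rewrite groupM ?groupV.
rewrite -{1}stab big_imfset /=; last by move=> ? ? _ _; apply: inj_msym.
by apply: eq_bigr => h _; rewrite mcoeff_msym.
Qed.

End Nullstellensatz.

(* Main.v *)
Require Import Defs.
From HB Require Import structures.
From mathcomp Require Import all_boot all_order all_fingroup all_algebra.
From mathcomp Require Import finmap.

(** A solution of the Nullstellensatz system is a choice of coefficients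
[c p], one for each product [p], such that the coefficients of
[\sum_p c p * p] and of the constant 1 agree at every monomial of degree at
most [q + d]; a solution of the orbit system is the same thing with [c]
constant on the orbits of [G].  This is what [nullM_solvable] and
[orbitM_solvable] say: in the orbit system only the equation at one
representative of each monomial orbit is written, but the sum of an orbit of
polynomials is [G]-invariant, so that the equations at the other monomials of
the orbit follow.

Hence a solution of the orbit system gives a solution of the full one by
copying each orbit coefficient to all the members of the orbit.  Conversely,
the constant 1 is fixed by [G] and [G] permutes the products, so that [G]
acts on the affine space of solutions of the full system; since [#|G|] is
invertible in [K], the mean of a solution over its translates by [G] exists,
is again a solution ([certificate_average]) and is constant on orbits
([average_orb]).  The two directions are joined in [certificate_orbits], for
an arbitrary [G]-stable finite set of polynomials and an arbitrary degree
bound: truncating at a degree is harmless because [G] preserves the degree of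
monomials. *)

Set Implicit Arguments.
Unset Strict Implicit.
Unset Printing Implicit Defensive.

Import GRing.Theory.
Local Open Scope ring_scope.
Local Open Scope fset_scope.

(* The library of group actions has a homonym: the action of a group through a
   morphism to a permutation group. *)
Local Notation mact := (@Defs.mact _).

(** * Linear systems indexed by finite sets *)

(** The unknowns become a function on the whole of [T], rather than a vector
indexed by an enumeration of [J]; sums over [J] can then be regrouped,
reindexed and averaged freely. *)
Lemma matrix_on_solvable (K : comNzRingType) (I : finType) (T : choiceType)
    (J : {fset T}) (E : I -> J -> K) (b : I -> K) :
  (exists y : 'cV[K]_#|{: J}|, matrix_on E *m y = colvec_on b) <->
  (exists c : T -> K, forall i, \sum_(j : J) c (val j) * E i j = b i).
Proof.
split=> [[y Ey] | [c Ec]].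
  exists (fun t => if insub t is Some j then y (enum_rank (j : J)) 0 else 0) => i.
  have /matrixP/(_ (enum_rank i) 0) := Ey.
  rewrite !mxE enum_rankK => <-.
  rewrite (eq_bigl (fun j => j \in {: J})) // big_enum_val.
  apply: eq_bigr => k _.
  by rewrite mxE enum_rankK valK enum_valK mulrC.
exists (\col_k c (val (enum_val k))).
apply/matrixP=> i k; rewrite !mxE -Ec.
rewrite [RHS](eq_bigl (fun j => j \in {: J})) // [RHS]big_enum_val.
by apply: eq_bigr => j _; rewrite !mxE mulrC.
Qed.

Lemma head_fset_mem (T : choiceType) (A : {fset T}) (x0 x : T) :
  x \in A -> head x0 (enum_fset A) \in A.
Proof.
have: x \in enum_fset A -> head x0 (enum_fset A) \in enum_fset A; last by [].
by case: (enum_fset A) => //= y s _; rewrite mem_head.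
Qed.

(** * The action on monomials and the orbits *)

Section Action.
Variable n : nat.
Implicit Types (m : 'X_{1..n}) (g : 'S_n) (G : {group 'S_n}).

Lemma mact0 g : mact g 0%MM = 0%MM.
Proof. by apply/mnmP=> i; rewrite !mnmE. Qed.

Lemma mact_eq0 g m : (mact g m == 0%MM) = (m == 0%MM).
Proof.
apply/eqP/eqP => [/mnmP gm0 | ->]; last exact: mact0.
by apply/mnmP=> i; have := gm0 (g i); rewrite !mnmE permK.
Qed.

Lemma mdeg_mact g m : mdeg (mact g m) = mdeg m.
Proof.
rewrite !mdegE [RHS](reindex_inj (@perm_inj _ (g^-1)%g)).
by apply: eq_bigr => i _; rewrite mnmE.
Qed.

(** Orbits contain the point they come from, so the default value in
[orb_repr] is never returned. *)
Lemma orb_repr_mem G m : orb_repr (orb mact G m) \in orb mact G m.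
Proof.
have : mact 1 m \in orb mact G m by apply/orbP; exists 1%g.
exact: head_fset_mem.
Qed.

(** The right-hand side of the orbit system singles out the orbit of the
monomial 1; since this monomial is fixed by every permutation, no other
monomial lies in that orbit. *)
Lemma orb_eq_orb0 G m :
  (orb mact G m == orb mact G 0%MM) = (m == 0%MM).
Proof.
apply/eqP/eqP => [eqO | -> //].
have : mact 1 m \in orb mact G 0%MM by rewrite -eqO; apply/orbP; exists 1%g.
by case/orbP=> g _ /eqP; rewrite mact0 mact_eq0 => /eqP.
Qed.

End Action.

(** * Averaging certificates over the group *)

Section Averaging.
Variables (K : fieldType) (n : nat) (G : {group 'S_n}).
Implicit Types (S : {fset {mpoly K[n]}}) (p : {mpoly K[n]}) (c : {mpoly K[n]} -> K).

Let polyorb p := orb (@msym n K) G p.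

Lemma mem_polyorb p : p \in polyorb p.
Proof. by apply/orbP; exists 1%g; rewrite ?msym1m. Qed.

Lemma polyorb_eq p q : (polyorb q == polyorb p) = (q \in polyorb p).
Proof.
apply/eqP/idP => [<- | /orbP[g Gg ->]]; first exact: mem_polyorb.
apply/fsetP=> r; apply/orbP/orbP => -[h Gh ->].
  by exists (g * h)%g; rewrite ?groupM // msymMm.
exists (g^-1 * h)%g; first by rewrite groupM ?groupV.
by rewrite -msymMm mulKVg.
Qed.

Definition stable S := forall g p, g \in G -> p \in S -> msym g p \in S.

(** An element of [G] permutes a [G]-stable finite set. *)
Lemma big_stable_msym S g (h : {mpoly K[n]} -> K) : stable S -> g \in G ->
  \sum_(p <- S) h (msym g p) = \sum_(p <- S) h p.
Proof.
move=> stS Gg.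
have imS : [fset msym g p | p in S] = S.
  apply/fsetP => p; apply/imfsetP/idP => /= [[q Sq ->] | Sp]; first exact: stS.
  exists (msym g^-1 p); first by rewrite stS ?groupV.
  by rewrite -msymMm mulVg msym1m.
by rewrite -{2}imS big_imfset //= => ? ? _ _; apply: inj_msym.
Qed.

Lemma sum_by_orbits S (h : {mpoly K[n]} -> K) : stable S ->
  \sum_(p <- S) h p =
  \sum_(P <- [fset polyorb p | p in S]) \sum_(p <- P) h p.
Proof.
move=> stS; rewrite (partition_big_imfset _ polyorb) /=.
apply: eq_big_seq => _ /imfsetP[q /= Sq ->].
rewrite -big_filter; apply: perm_big; apply: uniq_perm => [||p];
  rewrite ?filter_uniq ?fset_uniq //.
rewrite mem_filter polyorb_eq; apply: andb_idr => /orbP[g Gg ->].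
exact: stS.
Qed.

(** The identity [\sum_p c p * p = 1], read coefficientwise up to degree [N];
it is the identity itself as soon as [N] bounds the degrees in [S]. *)
Definition certificate N S c := forall m : 'X_{1..n}, (mdeg m <= N)%N ->
  \sum_(p <- S) c p * p@_m = (m == 0%MM)%:R.

Definition average c p := #|G|%:R^-1 * \sum_(g in G) c (msym g p).

Lemma average_orb c p q : q \in polyorb p -> average c q = average c p.
Proof.
case/orbP=> h Gh ->; congr (_ * _).
rewrite [RHS](reindex_inj (mulgI h)) /=.
by apply: eq_big => g; [rewrite groupMl | rewrite msymMm].
Qed.

(** Transporting [c] by [g] amounts to reading the equations of [c] at the
monomials [g m] instead of [m]; these have the same degree, and are 1 exactly
when [m] is.  So every translate of [c] is a certificate, and an affine
combination of certificates is one too. *)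
Lemma certificate_average N S c : stable S -> #|G|%:R != 0 :> K ->
  certificate N S c -> certificate N S (average c).
Proof.
move=> stS G0 cS m leNm.
transitivity (#|G|%:R^-1 * \sum_(g in G) \sum_(p <- S) c (msym g p) * p@_m).
  rewrite exchange_big mulr_sumr; apply: eq_bigr => p _.
  by rewrite /average -mulrA mulr_suml.
(* Each inner sum is the value at [m] of a translate of [c]. *)
rewrite (eq_bigr (fun=> (m == 0%MM)%:R)) => [|g Gg].
  by rewrite sumr_const -[X in _ * X]mulr_natl mulKf.
under eq_bigr do rewrite -(mcoeff_msym g m).
rewrite (big_stable_msym (fun p => c p * p@_(mact g m))) // cS ?mdeg_mact //.
by rewrite mact_eq0.
Qed.

Lemma certificate_orbits N S : stable S -> #|G|%:R != 0 :> K ->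
  (exists c, certificate N S c) <->
  (exists c : {fset {mpoly K[n]}} -> K, forall m, (mdeg m <= N)%N ->
     \sum_(P <- [fset polyorb p | p in S]) c P * (\sum_(p <- P) p@_m)
       = (m == 0%MM)%:R).
Proof.
move=> stS G0; split=> [[c cS] | [c cS]].
  (* The mean is constant on an orbit, so any member can serve to read it off;
     orbits are nonempty and the default 0 is never returned. *)
  exists (fun P => average c (head 0 (enum_fset P))) => m leNm.
  rewrite -(certificate_average stS G0 cS leNm) [RHS]sum_by_orbits //.
  apply: eq_big_seq => _ /imfsetP[q /= Sq ->].
  rewrite mulr_sumr; apply: eq_big_seq => p pq; congr (_ * _).
  rewrite (average_orb c pq); apply: average_orb.
  exact: head_fset_mem (mem_polyorb q).
exists (fun p => c (polyorb p)) => m leNm.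
rewrite -(cS m leNm) sum_by_orbits //.
apply: eq_big_seq => _ /imfsetP[q /= Sq ->].
rewrite mulr_sumr; apply: eq_big_seq => p pq; congr (c _ * _).
by apply/eqP; rewrite polyorb_eq.
Qed.

End Averaging.

(** * The two systems as certificates *)

Section Systems.
Variables (K : fieldType) (n : nat) (F : {fset {mpoly K[n]}}) (d : nat).
Variable G : {group 'S_n}.

Lemma products_stable : stable G F -> stable G (products F d).
Proof.
move=> stF g _ Gg /imfset2P[m /= _ [f /= Ff ->]].
rewrite rmorphM /= msym_mact; apply/imfset2P.
have mlt : (mdeg (mact g m) < d.+1)%N by rewrite mdeg_mact bmdeg.
by exists (BMultinom mlt); rewrite ?inE //; exists (msym g f) => //; apply: stF.
Qed.

Lemma nullM_solvable :
  (exists y : 'cV[K]_#|{: products F d}|, nullM F d *m y = nullb F d) <->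
  (exists c, certificate (max_degree F + d) (products F d) c).
Proof.
apply: iff_trans (matrix_on_solvable _ _) _.
split=> -[c cS]; exists c.
  move=> m leNm; rewrite big_seq_fsetE.
  exact: (cS (BMultinom (leNm : (_ < _.+1)%N))).
by move=> m; rewrite -(cS m (bmdeg m)) big_seq_fsetE.
Qed.

(** The equation written at the representative of an orbit is equivalent to the
equations at all its members, by the invariance of orbit sums
([mact_orb_sum]). *)
Lemma orbitM_solvable :
  (exists y : 'cV[K]_#|{: product_orbits F d G}|,
      orbitM F d G *m y = orbitb F d G) <->
  (exists c : {fset {mpoly K[n]}} -> K, forall m,
     (mdeg m <= max_degree F + d)%N ->
     \sum_(P <- product_orbits F d G) c P * (\sum_(p <- P) p@_m)
       = (m == 0%MM)%:R).
Proof.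
have reprE (c : {fset {mpoly K[n]}} -> K) m :
    \sum_(P <- product_orbits F d G) c P
      * (\sum_(p <- P) p@_(orb_repr (orb mact G m)))
    = \sum_(P <- product_orbits F d G) c P * (\sum_(p <- P) p@_m).
  apply: eq_big_seq => _ /imfsetP[p _ ->].
  by rewrite (mact_orb_sum _ (orb_repr_mem G m)).
apply: iff_trans (matrix_on_solvable _ _) _.
split=> -[c cS]; exists c.
  move=> m leNm; have OA : orb mact G m \in monomial_orbits F d G.
    by apply/imfsetP; exists (BMultinom (leNm : (_ < _.+1)%N)); rewrite ?inE.
  rewrite -reprE -(orb_eq_orb0 G) big_seq_fsetE.
  exact: (cS [` OA]).
move=> A; have /imfsetP[m /= _ EA] := valP A.
by rewrite EA orb_eq_orb0 -(cS m (bmdeg m)) -reprE big_seq_fsetE -EA.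
Qed.

End Systems.

Theorem theorem3p5 (K : closedFieldType) (n : nat) (F : {fset {mpoly K[n]}})
    (G : {group 'S_n}) (d : nat) (d_gt0 : (0 < d)%N)
    (F_closed : forall (g : 'S_n) (f : {mpoly K[n]}),
       g \in G -> f \in F -> msym g f \in F)
    (G_unit : (#|G|%:R : K) \is a GRing.unit) :
  (exists y : 'cV[K]_#|{: products F d}|, nullM F d *m y = nullb F d) <->
  (exists y : 'cV[K]_#|{: product_orbits F d G}|,
      orbitM F d G *m y = orbitb F d G).
Proof.
apply: iff_trans (nullM_solvable F d) _.
apply: iff_trans _ (iff_sym (orbitM_solvable F d G)).
apply: certificate_orbits; first exact: products_stable.
by rewrite -unitfE.
Qed.
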